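(* (a) Let $f:X\to Y$ be a continuous map between zero-dimensional locally compact Hausdorff spaces, let $(A,I)=(CO(X),CK(X))$, $(B,J)=(CO(Y),CK(Y))$, and let $\varphi=\Theta^t(f):B\to A$ be given by $\varphi(G)=f^{-1}(G)$. Then the map $f$ is open iff there exists a map $\psi:I\to J$ which satisfies the following two conditions: (OZL1) for every $b\in J$ and every $a\in I$, $a\wedge\varphi(b)=0$ implies $\psi(a)\wedge b=0$; (OZL2) for every $a\in I$, $\varphi(\psi(a))\ge a$. (b) For a $\mathbf{ZLBA}$-morphism $\varphi:(B,J)\to(A,I)$, call a map $\psi:I\to J$ satisfying (OZL1) and (OZL2) a lower P-preadjoint of $\varphi$. The category $\mathbf{OZLC}$ of all zero-dimensional locally compact Hausdorff spaces and all continuous open maps is dually equivalent to the category $\mathbf{OZLBA}$ whose objects are all ZLB-algebras and whose morphisms are all $\mathbf{ZLBA}$-morphisms having lower P-preadjoints.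
   Context: A space is zero-dimensional if its clopen subsets form a base. $CO(X)$ is the Boolean algebra of clopen subsets of $X$ and $CK(X)$ is the set of compact clopen subsets of $X$. For a distributive $\{0\}$-pseudolattice $I$ (a poset with least element $0$ and all finite non-empty meets and joins, distributive), $Idl(I)$ is the frame of all ideals of $I$; for $J\in Idl(I)$, $\neg J=\{a\in I : a\wedge b=0\ \text{for all } b\in J\}$. The ideal $J$ is simple if $J\vee\neg J=I$ in $Idl(I)$; $Si(I)$ is the set of simple ideals. A local Boolean algebra (LBA) is a pair $(A,I)$, where $A$ is a Boolean algebra and $I$ is an ideal of $A$ (possibly non-proper) which is dense in $A$, i.e. for every $a\in A\setminus\{0\}$ there is $b\in I\setminus\{0\}$ with $b\le a$. An LBA $(B,I)$ is a ZLB-algebra (ZLBA) if for every $J\in Si(I)$ the join $\bigvee_B J$ exists in $B$. The category $\mathbf{ZLBA}$ has ZLBAs as objects; its morphisms $\varphi:(A,I)\to(B,J)$ are the Boolean homomorphisms $\varphi:A\to B$ such that for every $b\in J$ there exists $a\in I$ with $b\le\varphi(a)$; composition is the usual composition of functions. Two categories are dually equivalent if one is equivalent to the opposite of the other. *)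

(* Defs.v *)
From HB Require Import structures.
From mathcomp Require Import all_boot all_order.
From mathcomp Require Import boolp classical_sets functions topology.

Set Implicit Arguments.
Unset Strict Implicit.
Unset Printing Implicit Defensive.

Import Order.Theory.

Record category := Category {
  obj :> Type;
  hom : obj -> obj -> Type;
  idm : forall a, hom a a;
  comp : forall a b c, hom b c -> hom a b -> hom a c;
  comp_idl : forall a b (f : hom a b), comp (idm b) f = f;
  comp_idr : forall a b (f : hom a b), comp f (idm a) = f;
  compA : forall a b c d (h : hom c d) (g : hom b c) (f : hom a b),
    comp h (comp g f) = comp (comp h g) f
}.

Arguments hom {_} _ _.
Arguments idm {_} _.
Arguments comp {_ _ _ _} _ _.

Definition opposite (C : category) : category :=
  @Category C (fun a b => hom b a) (@idm C) (fun a b c g f => comp f g)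
    (fun a b f => comp_idr f) (fun a b f => comp_idl f)
    (fun a b c d h g f => esym (compA f g h)).

Record functor (C D : category) := Functor {
  fobj :> C -> D;
  fmap : forall a b, hom a b -> hom (fobj a) (fobj b);
  fmap_id : forall a, fmap (idm a) = idm (fobj a);
  fmap_comp : forall a b c (g : hom b c) (f : hom a b),
    fmap (comp g f) = comp (fmap g) (fmap f)
}.

Arguments fmap {_ _} _ {_ _} _.

Definition functor_id (C : category) : functor C C :=
  @Functor C C id (fun _ _ f => f) (fun _ => erefl) (fun _ _ _ _ _ => erefl).

Lemma functor_comp_id (C D E : category) (G : functor D E) (F : functor C D) a :
  fmap G (fmap F (idm a)) = idm (G (F a)).
Proof. by rewrite !fmap_id. Qed.

Lemma functor_comp_comp (C D E : category) (G : functor D E) (F : functor C D)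
    a b c (g : hom b c) (f : hom a b) :
  fmap G (fmap F (comp g f)) = comp (fmap G (fmap F g)) (fmap G (fmap F f)).
Proof. by rewrite !fmap_comp. Qed.

Definition functor_comp (C D E : category) (G : functor D E) (F : functor C D) :
    functor C E :=
  @Functor C E (fun a => G (F a)) (fun _ _ f => fmap G (fmap F f))
    (functor_comp_id G F) (functor_comp_comp G F).

Definition isomorphism (C : category) (a b : C) (f : hom a b) : Prop :=
  exists g : hom b a, comp g f = idm a /\ comp f g = idm b.

Definition naturally_isomorphic (C D : category) (F G : functor C D) : Prop :=
  exists eta : forall a, hom (F a) (G a),
    (forall a, isomorphism (eta a)) /\
    (forall a b (f : hom a b), comp (eta b) (fmap F f) = comp (fmap G f) (eta a)).

Definition equivalent (C D : category) : Prop :=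
  exists (F : functor C D) (G : functor D C),
    naturally_isomorphic (functor_comp G F) (functor_id C) /\
    naturally_isomorphic (functor_comp F G) (functor_id D).

Definition dually_equivalent (C D : category) : Prop :=
  equivalent C (opposite D).

Section WideSubcategory.
Variables (C : category) (P : forall a b : C, hom a b -> Prop).
Hypothesis P_id : forall a, P (idm a).
Hypothesis P_comp : forall a b c (g : hom b c) (f : hom a b),
  P g -> P f -> P (comp g f).

Definition wide_hom (a b : C) := {f : hom a b | P f}.

Definition wide_id a : wide_hom a a := exist (@P a a) (idm a) (P_id a).

Definition wide_comp a b c (g : wide_hom b c) (f : wide_hom a b) :
    wide_hom a c :=
  exist (@P a c) (comp (sval g) (sval f)) (P_comp (svalP g) (svalP f)).

Lemma wide_comp_idl a b (f : wide_hom a b) : wide_comp (wide_id b) f = f.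
Proof. by case: f => f Pf; apply: eq_exist; rewrite /= comp_idl. Qed.

Lemma wide_comp_idr a b (f : wide_hom a b) : wide_comp f (wide_id a) = f.
Proof. by case: f => f Pf; apply: eq_exist; rewrite /= comp_idr. Qed.

Lemma wide_compA a b c d
    (h : wide_hom c d) (g : wide_hom b c) (f : wide_hom a b) :
  wide_comp h (wide_comp g f) = wide_comp (wide_comp h g) f.
Proof. by apply: eq_exist; rewrite /= compA. Qed.

Definition wide_subcategory : category :=
  Category wide_comp_idl wide_comp_idr wide_compA.

End WideSubcategory.

Section Spaces.
Local Open Scope classical_set_scope.

(* The library's [zero_dimensional] only asks clopen sets to separate points. *)
Definition clopen_base (X : topologicalType) : Prop :=
  basis [set U : set X | clopen U].

Record ZLC_space (X : topologicalType) : Prop := {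
  ZLC_zero_dim : clopen_base X;
  ZLC_locally_compact : locally_compact [set: X];
  ZLC_hausdorff : hausdorff_space X
}.

Definition open_map (X Y : topologicalType) (f : X -> Y) : Prop :=
  forall U : set X, open U -> open (f @` U).

Record ZLC_obj := ZLCObj {
  ZLC_top :> topologicalType;
  ZLC_topP : ZLC_space ZLC_top
}.

Definition cts_id (X : topologicalType) : continuousType X X := @idfun X.

Definition cts_comp (X Y Z : topologicalType)
    (g : continuousType Y Z) (f : continuousType X Y) : continuousType X Z :=
  g \o f.

Lemma cts_comp_idl (X Y : ZLC_obj) (f : continuousType X Y) :
  cts_comp (cts_id Y) f = f.
Proof. exact/continuousEP. Qed.

Lemma cts_comp_idr (X Y : ZLC_obj) (f : continuousType X Y) :
  cts_comp f (cts_id X) = f.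
Proof. exact/continuousEP. Qed.

Lemma cts_compA (X Y Z T : ZLC_obj) (h : continuousType Z T)
    (g : continuousType Y Z) (f : continuousType X Y) :
  cts_comp h (cts_comp g f) = cts_comp (cts_comp h g) f.
Proof. exact/continuousEP. Qed.

Definition ZLC : category :=
  @Category ZLC_obj (fun X Y => continuousType X Y)
    (fun X => cts_id X) (fun X Y Z => @cts_comp X Y Z)
    cts_comp_idl cts_comp_idr cts_compA.

Lemma open_map_id (X : topologicalType) : open_map (@idfun X).
Proof. by move=> U oU; rewrite image_id. Qed.

Lemma open_map_comp (X Y Z : topologicalType) (g : Y -> Z) (f : X -> Y) :
  open_map g -> open_map f -> open_map (g \o f).
Proof. by move=> og of_ U oU; rewrite -image_comp; apply/og/of_. Qed.

Definition OZLC : category :=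
  @wide_subcategory ZLC
    (fun (X Y : ZLC_obj) (f : continuousType X Y) => open_map f)
    (fun X => @open_map_id (X : ZLC_obj))
    (fun X Y Z g f =>
      @open_map_comp (X : ZLC_obj) (Y : ZLC_obj) (Z : ZLC_obj) _ _).

End Spaces.

Section LocalBooleanAlgebras.
Local Open Scope order_scope.

(* [J] is an ideal of the {0}-pseudolattice [P], for [P] a subset of [L] closed
   under the operations of a {0}-pseudolattice; with [P := setT] this is an
   ideal of [L] itself. *)
Record ideal_of d (L : bLatticeType d) (P J : set L) : Prop := {
  ideal_sub : (J `<=` P)%classic;
  ideal0 : J \bot;
  ideal_le : forall a b, P a -> J b -> a <= b -> J a;
  idealU : forall a b, J a -> J b -> J (a `|` b)
}.

Definition ideal_neg d (L : bLatticeType d) (P J : set L) : set L :=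
  [set a | P a /\ forall b, J b -> (a `&` b)%O = \bot]%classic.

(* The least ideal of [P] above [J] and [K]: their join in the frame of ideals. *)
Definition ideal_join d (L : bLatticeType d) (P J K : set L) : set L :=
  [set a | forall M, ideal_of P M ->
    (J `<=` M)%classic -> (K `<=` M)%classic -> M a]%classic.

Definition simple_ideal d (L : bLatticeType d) (P J : set L) : Prop :=
  ideal_of P J /\ ideal_join P J (ideal_neg P J) = P.

Record local_boolean_algebra d (A : ctbDistrLatticeType d) (I : set A) : Prop :=
{ LBA_ideal : ideal_of setT I;
  LBA_dense : forall a, a != \bot -> exists b, [/\ I b, b != \bot & b <= a]
}.

Record ZLB_algebra d (A : ctbDistrLatticeType d) (I : set A) : Prop := {
  ZLB_LBA : local_boolean_algebra I;
  ZLB_join : forall J, simple_ideal I J -> (supremums J !=set0)%classic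
}.

(* The library's [{tblmorphism A -> B}] only preserves [\bot] and [\top]. *)
Record boolean_homomorphism d d' (A : ctbDistrLatticeType d)
    (B : ctbDistrLatticeType d') (phi : A -> B) : Prop := {
  bool_homI : {morph phi : a b / a `&` b};
  bool_homU : {morph phi : a b / a `|` b};
  bool_hom0 : phi \bot = \bot;
  bool_hom1 : phi \top = \top;
  bool_homC : {morph phi : a / ~` a}
}.

Record ZLBA_morphism d d' (A : ctbDistrLatticeType d)
    (B : ctbDistrLatticeType d') (I : set A) (J : set B) (phi : A -> B) :
    Prop := {
  ZLBA_morph_bool : boolean_homomorphism phi;
  ZLBA_morph_cofinal : forall b, J b -> exists2 a, I a & b <= phi a
}.

Section Preadjoints.
Variables (d d' : Order.disp_t).
Variables (A : ctbDistrLatticeType d) (B : ctbDistrLatticeType d').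
Variables (I : set A) (J : set B) (phi : B -> A) (psi : I -> J).

Definition OZL1 : Prop := forall (b : B) (a : I), J b ->
  val a `&` phi b = \bot -> val (psi a) `&` b = \bot.

Definition OZL2 : Prop := forall a : I, val a <= phi (val (psi a)).

Definition lower_P_preadjoint : Prop := OZL1 /\ OZL2.

End Preadjoints.

Record ZLBA_obj := ZLBAObj {
  ZLBA_disp : Order.disp_t;
  ZLBA_alg :> ctbDistrLatticeType ZLBA_disp;
  ZLBA_ideal : set ZLBA_alg;
  ZLBA_objP : ZLB_algebra ZLBA_ideal
}.

Arguments ZLBA_ideal _ : clear implicits.

Definition ZLBA_hom (A B : ZLBA_obj) :=
  {phi : A -> B | ZLBA_morphism (ZLBA_ideal A) (ZLBA_ideal B) phi}.

Lemma bool_hom_le d d' (A : ctbDistrLatticeType d)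
    (B : ctbDistrLatticeType d') (phi : A -> B) :
  boolean_homomorphism phi -> {homo phi : a b / a <= b}.
Proof. by move=> hphi a b /meet_idPl <-; rewrite (bool_homI hphi) leIr. Qed.

Lemma ZLBA_morphism_id (A : ZLBA_obj) :
  ZLBA_morphism (ZLBA_ideal A) (ZLBA_ideal A) idfun.
Proof. by split=> // b Ib; exists b. Qed.

Lemma ZLBA_morphism_comp (A B C : ZLBA_obj) (g : B -> C) (f : A -> B) :
  ZLBA_morphism (ZLBA_ideal B) (ZLBA_ideal C) g ->
  ZLBA_morphism (ZLBA_ideal A) (ZLBA_ideal B) f ->
  ZLBA_morphism (ZLBA_ideal A) (ZLBA_ideal C) (g \o f).
Proof.
move=> [hg cg] [hf cf]; split.
  by split=> [a b|a b|||a] /=;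
    rewrite ?(bool_homI hf) ?(bool_homU hf) ?(bool_hom0 hf) ?(bool_hom1 hf)
      ?(bool_homC hf) ?(bool_homI hg) ?(bool_homU hg) ?(bool_hom0 hg)
      ?(bool_hom1 hg) ?(bool_homC hg).
move=> c /cg[b /cf[a Ia ba] cb].
by exists a => //; apply: le_trans cb _; exact: bool_hom_le.
Qed.

Definition ZLBA_idm (A : ZLBA_obj) : ZLBA_hom A A :=
  exist _ idfun (ZLBA_morphism_id A).

Definition ZLBA_comp (A B C : ZLBA_obj) (g : ZLBA_hom B C)
    (f : ZLBA_hom A B) : ZLBA_hom A C :=
  exist _ (sval g \o sval f) (ZLBA_morphism_comp (svalP g) (svalP f)).

Lemma ZLBA_comp_idl (A B : ZLBA_obj) (f : ZLBA_hom A B) :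
  ZLBA_comp (ZLBA_idm B) f = f.
Proof. by case: f => f hf; exact: eq_exist. Qed.

Lemma ZLBA_comp_idr (A B : ZLBA_obj) (f : ZLBA_hom A B) :
  ZLBA_comp f (ZLBA_idm A) = f.
Proof. by case: f => f hf; exact: eq_exist. Qed.

Lemma ZLBA_compA (A B C D : ZLBA_obj) (h : ZLBA_hom C D) (g : ZLBA_hom B C)
    (f : ZLBA_hom A B) :
  ZLBA_comp h (ZLBA_comp g f) = ZLBA_comp (ZLBA_comp h g) f.
Proof. exact: eq_exist. Qed.

Definition ZLBA : category :=
  @Category ZLBA_obj ZLBA_hom ZLBA_idm ZLBA_comp
    ZLBA_comp_idl ZLBA_comp_idr ZLBA_compA.

Definition has_lower_P_preadjoint (A B : ZLBA) (phi : hom A B) : Prop :=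
  exists psi : ZLBA_ideal B -> ZLBA_ideal A,
    lower_P_preadjoint (sval (phi : ZLBA_hom A B)) psi.

Lemma has_lower_P_preadjoint_id (A : ZLBA) : has_lower_P_preadjoint (idm A).
Proof. by exists id; split. Qed.

Lemma has_lower_P_preadjoint_comp (A B C : ZLBA) (g : hom B C) (f : hom A B) :
  has_lower_P_preadjoint g -> has_lower_P_preadjoint f ->
  has_lower_P_preadjoint (comp g f).
Proof.
move=> [psig [g1 g2]] [psif [f1 f2]]; exists (psif \o psig); split.
  move=> a c Ia /= cga; apply: f1 => //.
  have Ib : ZLBA_ideal B (val (psig c)) by exact: set_mem (valP (psig c)).
  have IB := LBA_ideal (ZLB_LBA (ZLBA_objP B)).
  have := g1 (val (psig c) `&` sval f a) c.
  rewrite meetA meetxx; apply; first exact: ideal_le IB _ _ I Ib (leIl _ _).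
  by rewrite (bool_homI (ZLBA_morph_bool (svalP g))) meetCA cga meetx0.
move=> c; apply: le_trans (g2 c) _; apply: bool_hom_le (f2 _).
exact: ZLBA_morph_bool (svalP g).
Qed.

Definition OZLBA : category :=
  wide_subcategory has_lower_P_preadjoint_id has_lower_P_preadjoint_comp.

End LocalBooleanAlgebras.

Definition CO (X : topologicalType) :=
  {U : set X | U \in [set V : set X | clopen V]%classic}.

Section ClopenAlgebra.
Variable X : topologicalType.

Definition clopens : {pred set X} := fun U => U \in [set V | clopen V]%classic.

HB.instance Definition _ := [isSub of CO X for sval].
HB.instance Definition _ := [Choice of CO X by <:].

Lemma clopens_meet : meet_closed clopens.
Proof. by move=> U V; rewrite !inE; exact: clopenI. Qed.

Lemma clopens_join : join_closed clopens.
Proof. by move=> U V; rewrite !inE; exact: clopenU. Qed.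

Lemma clopens0 : (\bot : set X)%O \in clopens.
Proof. by rewrite inE; exact: clopen0. Qed.

Lemma clopens1 : (\top : set X)%O \in clopens.
Proof. by rewrite inE; exact: clopenT. Qed.

HB.instance Definition _ := Order.SubChoice_isTBSubLattice.Build
  set_display (set X) clopens set_display (CO X)
  clopens_meet clopens_join clopens0 clopens1.

Lemma CO_meetUl : @left_distributive (CO X) (CO X) Order.meet Order.join.
Proof. by move=> U V W; apply: val_inj; exact: meetUl. Qed.

HB.instance Definition _ :=
  Order.Lattice_Meet_isDistrLattice.Build set_display (CO X) CO_meetUl.

Lemma CO_compl_subproof (U : CO X) : (~` val U)%classic \in clopens.
Proof.
have [oU cU] : clopen (val U) by exact: set_mem (valP U).
by rewrite inE; split; [exact: closed_openC|exact: open_closedC].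
Qed.

Definition CO_compl (U : CO X) : CO X :=
  Sub (~` val U)%classic (CO_compl_subproof U).

Lemma CO_joinxC U : (U `|` CO_compl U = \top)%O.
Proof. by apply: val_inj; exact: setUv. Qed.

Lemma CO_meetxC U : (U `&` CO_compl U = \bot)%O.
Proof. by apply: val_inj; exact: setICr. Qed.

HB.instance Definition _ := Order.TBDistrLattice_hasComplement.Build
  set_display (CO X) CO_joinxC CO_meetxC.

End ClopenAlgebra.

Definition CK (X : topologicalType) : set (CO X) :=
  [set U : CO X | compact (val U)]%classic.

Arguments CK X : clear implicits.

Section ClopenPreimage.
Variables (X Y : topologicalType) (f : continuousType X Y).

Lemma CO_preimage_subproof (G : CO Y) :
  (f @^-1` val G)%classic \in [set V | clopen V]%classic.
Proof.
rewrite inE; apply: preimage_clopen; [exact: set_mem (valP G)|exact: cts_fun].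
Qed.

Definition CO_preimage (G : CO Y) : CO X :=
  Sub (f @^-1` val G)%classic (CO_preimage_subproof G).

End ClopenPreimage.

(* Main.v *)
From HB Require Import structures.
From mathcomp Require Import all_boot all_order.
From mathcomp Require Import boolp classical_sets functions topology.
Require Import Defs.

(** Why the theorem is true.

    Part (a).  If [f] is open then [psi K := f @` K] works: the image of a
    compact open set is compact and open, hence clopen in a Hausdorff space.
    Conversely (OZL1) and (OZL2) leave no choice for [psi].  By (OZL2) the set
    [f @` K] lies in [psi K]; a point of [psi K] outside the compact set
    [f @` K] would have a compact clopen neighbourhood [b] missing [f @` K], and
    (OZL1) would make [b] miss [psi K].  So [f @` K = psi K] is open for every
    compact clopen [K], and such [K] form a base ([preadjoint_open_map]).

    Part (b).  The contravariant functor sending [X] to [(CO X, CK X)] and [f] to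
    the preimage map is fully faithful and essentially surjective, which is
    enough for an equivalence ([full_faithful_esurj_equivalent]).  By part (a)
    the open maps are exactly those whose preimage map has a lower P-preadjoint,
    so openness never has to be examined again.

    Fullness ([CO_preimage_full]): a morphism [phi : CO Y -> CO X] sends each
    point [x] to the ultrafilter [{G | x \in phi G}] of [CO Y].  The cofinality
    condition on morphisms says that this ultrafilter contains a compact set,
    and then compactness makes it the ultrafilter of a point of [Y]
    ([CO_ultrafilter_principal]), which is the value at [x] of the map sought.

    Essential surjectivity ([CO_functor_esurj]): a ZLB-algebra [(A, I)] is
    recovered from the space of those ultrafilters of [A] that meet [I], where
    the Stone map sends [a] to the set of ultrafilters containing [a].  It is
    injective by density of [I] and the existence of ultrafilters, and it
    carries [I] onto the compact clopen sets.  The existence of joins of simple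
    ideals is what makes it onto [CO] ([stone_onto]): a clopen [G] cuts [I]
    along the simple ideal [{a \in I | stone a `<=` G}], and the join of this
    ideal is the element represented by [G]. *)

Set Implicit Arguments.
Unset Strict Implicit.
Unset Printing Implicit Defensive.

Import Order.Theory.

Local Open Scope classical_set_scope.

(** * Equivalences of categories *)

Section Equivalence.
Variables (C D : category) (F : functor C D).
Hypothesis F_faithful :
  forall a b (f g : hom a b), fmap F f = fmap F g -> f = g.
Hypothesis F_full : forall a b (h : hom (F a) (F b)), exists f, fmap F f = h.
Hypothesis F_esurj :
  forall d : D, exists (c : C) (e : hom (F c) d), isomorphism e.

Lemma full_faithful_isomorphism a b (f : hom a b) :
  isomorphism (fmap F f) -> isomorphism f.
Proof.
move=> [h [hf fh]]; have [g Fg] := F_full h.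
by exists g; split; apply: F_faithful; rewrite fmap_comp fmap_id Fg.
Qed.

(** The inverse functor is obtained by choosing preimages of objects, and of
    morphisms conjugated by the chosen isomorphisms; faithfulness makes the
    choice functorial. *)
Lemma full_faithful_esurj_equivalent : equivalent C D.
Proof.
have [c0 /all_sig[e eiso]] : {c0 : D -> C &
    forall d, {e : hom (F (c0 d)) d | isomorphism e}}.
  suff /all_tag[c0 c0P] : forall d, {c : C & {e : hom (F c) d | isomorphism e}}.
    by exists c0.
  by move=> d; have /cid[c /cid[f fP]] := F_esurj d; exists c, f.
have /all_sig[e' /all_and2[e'e ee']] d := cid (eiso d).
have lift d d' (h : hom d d') :
    {f : hom (c0 d) (c0 d') | fmap F f = comp (e' d') (comp h (e d))}.
  exact/cid/F_full.
pose q d d' (h : hom d d') := sval (lift d d' h).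
have qP d d' (h : hom d d') : fmap F (q d d' h) = comp (e' d') (comp h (e d)).
  exact: svalP (lift d d' h).
have q_id d : q d d (idm d) = idm (c0 d).
  by apply: F_faithful; rewrite qP comp_idl e'e fmap_id.
have q_comp d1 d2 d3 (g : hom d2 d3) (f : hom d1 d2) :
    q d1 d3 (comp g f) = comp (q d2 d3 g) (q d1 d2 f).
  apply: F_faithful; rewrite fmap_comp !qP !compA.
  by rewrite -(compA _ (e d2) (e' d2)) ee' comp_idr.
exists F, (Functor q_id q_comp); split; last first.
  exists e; split=> // d d' h /=.
  by rewrite qP !compA ee' comp_idl.
(* The component at [c] of [G F ~ id] is the lift of [e (F c)]. *)
have /all_sig[eta etaP] c := cid (F_full (e (F c))).
exists eta; split=> [c|c c' f].
  by apply: full_faithful_isomorphism; rewrite etaP; exact: eiso.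
apply: F_faithful; rewrite /= !fmap_comp qP !etaP !compA.
by rewrite ee' comp_idl.
Qed.
End Equivalence.

(** * Compact clopen sets *)

Section ClopenSets.
Variable X : topologicalType.

Definition CO_of_clopen (U : set X) (cU : clopen U) : CO X := Sub U (mem_set cU).

Definition CK_of_compact (K : CO X) (cK : CK X K) : CK X :=
  exist (fun U : CO X => U \in CK X) K (mem_set cK).

Lemma CO_clopen (U : CO X) : clopen (val U).
Proof. exact: set_mem (valP U). Qed.

Lemma CO_leP (U V : CO X) : (U <= V)%O <-> val U `<=` val V.
Proof. by rewrite -subsetEset -Order.le_val. Qed.

Lemma CO_meet_disjoint (U V : CO X) :
  (U `&` V)%O = \bot%O <-> forall x, val U x -> ~ val V x.
Proof.
split=> [UV x Ux Vx|UV].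
  have : val (U `&` V)%O x by split.
  by rewrite UV.
apply: val_inj; rewrite /= -[RHS]/(set0 : set X) predeqE => x.
by split=> // -[/UV].
Qed.

Hypothesis ZX : ZLC_space X.

(** In a zero-dimensional locally compact Hausdorff space the compact clopen sets
    form a base: a clopen set inside a compact neighbourhood is compact. *)
Lemma CK_nbhs (U : set X) x : open U -> U x ->
  exists K : CO X, [/\ CK X K, val K x & val K `<=` U].
Proof.
move=> oU Ux; have [_ base] := ZLC_zero_dim ZX.
have [K nK [cptK clK]] := ZLC_locally_compact ZX (x := x) I.
have /base[G [cG Gx] GKU] : nbhs x (K `&` U).
  apply: filterI; last exact: open_nbhs_nbhs.
  move: nK; rewrite /within /=; apply: filterS => y; exact.
exists (CO_of_clopen cG); split=> //=; last by move=> y /GKU[].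
by apply: subclosed_compact cptK _; [case: cG|move=> y /GKU[]].
Qed.

Lemma compact_open_clopen (K : set X) : compact K -> open K -> clopen K.
Proof.
by move=> cK oK; split=> //; apply: compact_closed => //; exact: ZLC_hausdorff ZX.
Qed.

Lemma CO_separate x y :
  (forall G : CO X, val G x -> val G y) -> x = y.
Proof.
move=> xy; apply: (ZLC_hausdorff ZX) => U V nU nV.
suff Uy : U y by exists y; split=> //; exact: nbhs_singleton.
have [_ base] := ZLC_zero_dim ZX.
by have [G [cG Gx] GU] := base x _ nU; apply/GU/(xy (CO_of_clopen cG)).
Qed.

End ClopenSets.

(** * Open maps and lower P-preadjoints *)

Section OpenMaps.
Variables (X Y : topologicalType) (f : continuousType X Y).
Hypotheses (ZX : ZLC_space X) (ZY : ZLC_space Y).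

Lemma compact_image (K : set X) : compact K -> compact (f @` K).
Proof.
apply: continuous_compact; apply: continuous_subspaceT; exact: cts_fun.
Qed.

(** The preadjoint is the direct image. *)
Lemma open_map_preadjoint :
  open_map f ->
  exists psi : CK X -> CK Y, lower_P_preadjoint (CO_preimage f) psi.
Proof.
move=> of_.
have cf (K : CK X) : compact (f @` val (val K)).
  exact/compact_image/(set_mem (valP K)).
have oc (K : CK X) : clopen (f @` val (val K)).
  by apply: (compact_open_clopen ZY (cf K)); apply: of_; case: (CO_clopen (val K)).
have KP (K : CK X) : CK Y (CO_of_clopen (oc K)) by exact: cf.
exists (fun K => CK_of_compact (KP K)); split.
  move=> b a _ /CO_meet_disjoint ab; apply/CO_meet_disjoint.
  by move=> _ [x ax <-]; exact: ab.
by move=> a; apply/CO_leP => x ax; exists x.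
Qed.

(** The two conditions force [psi K] to be the direct image of [K]. *)
Lemma preadjoint_open_map :
  (exists psi : CK X -> CK Y, lower_P_preadjoint (CO_preimage f) psi) ->
  open_map f.
Proof.
move=> [psi [psi1 psi2]].
have psiE (K : CK X) : f @` val (val K) = val (val (psi K)).
  apply/seteqP; split=> [_ [x Kx <-]|y psiy].
    exact: ((CO_leP _ _).1 (psi2 K) x Kx).
  apply: contrapT => nKy.
  have cfK : closed (f @` val (val K)).
    apply: compact_closed; first exact: ZLC_hausdorff ZY.
    exact/compact_image/(set_mem (valP K)).
  have [b [Jb bY bK]] := CK_nbhs ZY (closed_openC cfK) nKy.
  have : (val K `&` CO_preimage f b)%O = \bot%O.
    by apply/CO_meet_disjoint => x Kx /bK; apply; exists x.
  by move=> /(psi1 _ _ Jb)/CO_meet_disjoint/(_ y psiy).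
move=> U oU; rewrite openE => _ [x Ux <-].
have [K [cK Kx KU]] := CK_nbhs ZX oU Ux.
have := psiE (CK_of_compact cK) => fK.
rewrite /interior nbhsE; exists (f @` val K); last exact: image_subset.
split; last by exists x.
by rewrite fK; have [] := CO_clopen (val (psi (CK_of_compact cK))).
Qed.

End OpenMaps.

(** * Compactness along directed families *)

(** Compactness in the form used throughout: if no [u i] contained [C], the sets
    [C `\` u i] would generate a proper filter, and a cluster point of it in [C]
    lies in the interior of no [u i]. *)
Lemma compact_directed_cover (X : topologicalType) (C : set X) (T : Type)
    (D : set T) (u : T -> set X) :
  compact C -> D !=set0 ->
  (forall i j, D i -> D j -> exists2 k, D k & u i `|` u j `<=` u k) ->
  (forall x, C x -> exists2 i, D i & nbhs x (u i)) ->
  exists2 i, D i & C `<=` u i.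
Proof.
move=> cptC [i0 Di0] dir cov; apply: contrapT => nocov.
have FF : ProperFilter (filter_from D (fun i => C `\` u i)).
  apply: filter_from_proper => [|i Di].
    apply: filter_from_filter => [|i j Di Dj]; first by exists i0.
    have [k Dk uk] := dir i j Di Dj; exists k => // x [Cx nkx].
    by split; split=> // ?; apply/nkx/uk; [left|right].
  apply: contrapT => Ci0; apply: nocov; exists i => // x Cx.
  by apply: contrapT => nx; apply: Ci0; exists x.
have [|x [Cx Fx]] := cptC _ FF; first by exists i0 => // x [].
have [i Di ix] := cov x Cx.
by have [|y [[_ nuy] uy]] := Fx (C `\` u i) (u i) _ ix; [exists i|].
Qed.

(** * Spaces give ZLB-algebras *)

Section Ideals.
Local Open Scope order_scope.

(** The elements of [P] below some [j `|` k] form an ideal containing both. *)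
Lemma ideal_join_le d (L : bLatticeType d) (P J K : set L) a :
  ideal_of setT P -> ideal_of P J -> ideal_of P K -> ideal_join P J K a ->
  exists j k, [/\ J j, K k & a <= (j `|` k)%O].
Proof.
move=> iP iJ iK.
pose M := [set b | P b /\ exists j k, [/\ J j, K k & b <= (j `|` k)%O]]%classic.
suff iM : ideal_of P M.
  move=> /(_ M iM)[b Jb|b Kb|//].
  - split; first exact: ideal_sub iJ _ Jb.
    by exists b, \bot; split=> //; [exact: ideal0 iK|exact: leUl].
  - split; first exact: ideal_sub iK _ Kb.
    by exists \bot, b; split=> //; [exact: ideal0 iJ|exact: leUr].
split=> [b [] //||b c Pb [_ [j [k [Jj Kk cjk]]]] bc|b c].
- split; first exact: ideal0 iP.
  by exists \bot, \bot; split; [exact: ideal0 iJ|exact: ideal0 iK|exact: le0x].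
- by split=> //; exists j, k; split=> //; exact: le_trans cjk.
move=> [Pb [j [k [Jj Kk bjk]]]] [Pc [j' [k' [Jj' Kk' cjk]]]].
split; first exact: idealU iP _ _ Pb Pc.
exists (j `|` j')%O, (k `|` k')%O; split.
- exact: idealU iJ _ _ Jj Jj'.
- exact: idealU iK _ _ Kk Kk'.
by rewrite joinACA; exact: leU2.
Qed.

Lemma ideal_neg_ideal d (L : bDistrLatticeType d) (P J : set L) :
  ideal_of setT P -> ideal_of P (ideal_neg P J).
Proof.
move=> iP; split=> [b [] //||b c Pb [Pc cJ] bc|b c [Pb bJ] [Pc cJ]].
- by split; [exact: ideal0 iP|move=> b _; exact: meet0x].
- split=> // j Jj; apply/eqP; rewrite -lex0 -(cJ j Jj); exact: leI2.
- split; first exact: idealU iP _ _ Pb Pc.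
  by move=> j Jj; rewrite meetUl bJ// cJ// joinxx.
Qed.

End Ideals.

Section ClopenZLB.
Variables (X : topologicalType) (ZX : ZLC_space X).

Lemma CK_ideal : ideal_of setT (CK X).
Proof.
split=> [//||U V _ cV /CO_leP UV|U V]; first exact: compact0.
  by apply: subclosed_compact cV UV; case: (CO_clopen U).
exact: compactU.
Qed.

Lemma CO_eq0P (U : CO X) : U != \bot%O -> exists x, val U x.
Proof.
move=> /eqP U0; apply: contrapT => nU; apply: U0; apply: val_inj.
by rewrite /= -[RHS]/(set0 : set X) predeqE => x; split=> // Ux; apply: nU; exists x.
Qed.

(** The join of a simple ideal [J] of [CK X] is its union.  The union is closed
    because a compact clopen neighbourhood of a point outside it splits along
    [J] and [ideal_neg J], so the point has a neighbourhood in the latter. *)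
Lemma CO_ZLB : ZLB_algebra (CK X).
Proof.
split.
  split; first exact: CK_ideal.
  move=> U /CO_eq0P[x Ux]; have [oU _] := CO_clopen U.
  have [K [cK Kx KU]] := CK_nbhs ZX oU Ux.
  exists K; split=> //; last exact/CO_leP.
  by apply/eqP => K0; move: Kx; rewrite K0.
move=> J [iJ simJ].
pose W := \bigcup_(U in J) val U.
have oW : open W by apply: bigcup_open => U _; case: (CO_clopen U).
have cW : clopen W.
  split=> //; rewrite -[W]setCK; apply: open_closedC.
  rewrite openE => x nWx.
  have [K [cK Kx _]] := CK_nbhs ZX openT (I : setT x).
  have : ideal_join (CK X) J (ideal_neg (CK X) J) K by rewrite simJ.
  have iN := ideal_neg_ideal J CK_ideal.
  case/(ideal_join_le CK_ideal iJ iN) => U [V [JU [_ VJ] /CO_leP KUV]].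
  have Vx : val V x by case: (KUV x Kx) => // Ux; case: nWx; exists U.
  rewrite /interior nbhsE; exists (val V).
    by split=> //; case: (CO_clopen V).
  by move=> y Vy [U' JU' U'y]; exact: (CO_meet_disjoint _ _).1 (VJ _ JU') y Vy U'y.
exists (CO_of_clopen cW); split=> [U JU|V VJ]; apply/CO_leP => x; first by exists U.
by move=> [U JU Ux]; exact: ((CO_leP _ _).1 (VJ U JU)).
Qed.

End ClopenZLB.

(** * Preimage maps *)

Section PreimageMaps.
Variables (X Y : topologicalType).
Hypothesis ZY : ZLC_space Y.

Lemma compact_sub_CK (C : set Y) : compact C -> exists2 G, CK Y G & C `<=` val G.
Proof.
move=> cC; apply: (compact_directed_cover cC).
- by exists \bot%O; exact: compact0.
- move=> G H cG cH; exists (G `|` H)%O => //; exact: compactU.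
move=> y _; have [G [cG Gy _]] := CK_nbhs ZY openT (I : setT y).
exists G => //; apply: open_nbhs_nbhs; split=> //.
by case: (CO_clopen G).
Qed.

Lemma CO_preimage_morphism (f : continuousType X Y) :
  ZLBA_morphism (CK Y) (CK X) (CO_preimage f).
Proof.
split; first by split=> [U V|U V|||U]; apply: val_inj.
move=> K /(compact_image (f:=f))/compact_sub_CK[G cG KG].
by exists G => //; apply/CO_leP => x Kx; apply: KG; exists x.
Qed.

(** Clopen sets separate the points of the target. *)
Lemma CO_preimage_inj (f g : continuousType X Y) :
  CO_preimage f =1 CO_preimage g -> f = g.
Proof.
move=> fg; apply/continuousEP => x; apply: (CO_separate ZY) => G Gfx.
by have := congr1 (fun U : CO X => val U x) (fg G) => /= <-.
Qed.

End PreimageMaps.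


(** * Bounded ultrafilters *)

Section BoundedUltrafilters.
Local Open Scope order_scope.

(** Boundedness, that is meeting [I], singles out the points of a locally compact
    space among the ultrafilters of its clopen sets: the unbounded ones are the
    points at infinity of the Stone space of the whole algebra. *)
Record bounded_ultrafilter d (A : ctbDistrLatticeType d) (I u : set A) : Prop := {
  bufI : forall a b, u a -> u b -> u (a `&` b)%O;
  buf_le : forall a b, u a -> a <= b -> u b;
  buf0 : ~ u \bot;
  buf_or : forall a, u a \/ u (~` a)%O;
  buf_bounded : exists2 a, I a & u a
}.

Variables (d : Order.disp_t) (A : ctbDistrLatticeType d) (I u : set A).
Hypothesis uP : bounded_ultrafilter I u.

Lemma bufC a : u (~` a)%O <-> ~ u a.
Proof.
split=> [uCa ua|]; last by case: (buf_or uP a).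
by apply: (buf0 uP); rewrite -(meetxC a); exact: bufI uP _ _ ua uCa.
Qed.

Lemma buf_meet a b : u (a `&` b)%O <-> u a /\ u b.
Proof.
split=> [uab|[ua ub]]; last exact: bufI uP _ _ ua ub.
by split; apply: (buf_le uP uab); [exact: leIl|exact: leIr].
Qed.

Lemma buf_join a b : u (a `|` b)%O <-> u a \/ u b.
Proof.
split=> [uab|[ua|ub]]; last 2 first.
- by apply: (buf_le uP ua); exact: leUl.
- by apply: (buf_le uP ub); exact: leUr.
apply: contrapT => /not_orP[/bufC na /bufC nb].
apply: (buf0 uP); rewrite -(meetxC (a `|` b)%O) complU.
by apply: (bufI uP uab); exact: bufI uP _ _ na nb.
Qed.

Lemma buf1 : u \top.
Proof. by have [a _ ua] := buf_bounded uP; apply: (buf_le uP ua); exact: lex1. Qed.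

End BoundedUltrafilters.

(** A compact member [K] of [u] cannot be covered by the complements of the
    members, which form a directed family; a point left over lies in all of
    them. *)
Lemma CO_ultrafilter_principal (Y : topologicalType) (u : set (CO Y)) :
  bounded_ultrafilter (CK Y) u -> exists y, forall G, u G <-> val G y.
Proof.
move=> uP; have [K cK uK] := buf_bounded uP.
suff [y yP] : exists y, forall G, u G -> val G y.
  exists y => G; split; first exact: yP.
  by move=> Gy; case: (buf_or uP G) => // /yP /(_ Gy).
apply: contrapT => noy.
have [G uG KG] : exists2 G, u G & val K `<=` ~` val G.
  apply: (compact_directed_cover cK); first by exists K.
    move=> G H uG uH; exists (G `&` H)%O; first exact: bufI uP _ _ uG uH.
    by rewrite -setCI.
  move=> y _; apply: contrapT => nG; apply: noy; exists y => G uG.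
  apply: contrapT => nGy; apply: nG; exists G => //.
  apply: open_nbhs_nbhs; split=> //.
  by apply: closed_openC; case: (CO_clopen G).
apply: (buf0 uP); suff <- : (K `&` G)%O = \bot%O by exact: bufI uP _ _ uK uG.
exact/CO_meet_disjoint.
Qed.

Section Full.
Variables (X Y : topologicalType) (phi : CO Y -> CO X).
Hypotheses (ZX : ZLC_space X) (ZY : ZLC_space Y).
Hypothesis phiP : ZLBA_morphism (CK Y) (CK X) phi.

(** The cofinality condition on [phi] is what makes this ultrafilter bounded. *)
Lemma morphism_point_ultrafilter x :
  bounded_ultrafilter (CK Y) [set G | val (phi G) x].
Proof.
have [hphi cof] := phiP; split=> /=.
- by move=> G H Gx Hx; rewrite (bool_homI hphi).
- by move=> G H Gx GH; exact: (CO_leP _ _).1 (bool_hom_le hphi GH) x Gx.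
- by rewrite (bool_hom0 hphi).
- by move=> G; rewrite (bool_homC hphi); exact: EM.
have [K [cK Kx _]] := CK_nbhs ZX openT (I : setT x).
by have [G cG KG] := cof K cK; exists G => //; exact: (CO_leP _ _).1 KG x Kx.
Qed.

Lemma CO_preimage_full : exists f : continuousType X Y, CO_preimage f =1 phi.
Proof.
have /all_sig[f fP] x :=
  cid (CO_ultrafilter_principal (morphism_point_ultrafilter x)).
have cf : continuous f.
  apply/continuousP => U oU; rewrite openE => x Ux.
  have [K [_ Kx KU]] := CK_nbhs ZY oU Ux.
  rewrite /interior nbhsE; exists (val (phi K)).
    by split; [case: (CO_clopen (phi K))|exact: (fP x K).2].
  by move=> z /(fP z K) /KU.
pose F := isContinuous.Build X Y f cf.
pose g : continuousType X Y := HB.pack f F.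
exists g => G; apply: val_inj; rewrite predeqE => x; exact: iff_sym (fP x G).
Qed.

End Full.

Section UltrafilterExistence.
Local Open Scope order_scope.
Variables (d : Order.disp_t) (A : ctbDistrLatticeType d) (I : set A).

(** A maximal proper filter containing [b] exists by Zorn's lemma; it contains
    [a] or [~` a], since otherwise [a] could be adjoined to it. *)
Lemma bounded_ultrafilter_exists b :
  I b -> b != \bot -> exists2 u, bounded_ultrafilter I u & u b.
Proof.
move=> Ib /eqP b0.
(* The empty set is admitted because it is the union of the empty chain. *)
pose P (S : set A) := (S !=set0)%classic -> [/\ S b,
  forall x y, S x -> S y -> S (x `&` y)%O,
  forall x y, S x -> x <= y -> S y & ~ S \bot].
have [F FP totF|S [PS maxS]] := @Zorn_bigcup A P.
  have big x y S S' : F S -> F S' -> S x -> S' y -> exists T, [/\ F T, T x & T y].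
    move=> FS FS' Sx S'y; have [SS'|S'S] := totF _ _ FS FS'.
      by exists S'; split=> //; exact: SS'.
    by exists S; split=> //; exact: S'S.
  move=> [x [S FS Sx]]; split.
  - by exists S => //; have [] := FP S FS (ex_intro _ x Sx).
  - move=> y z [S1 FS1 S1y] [S2 FS2 S2z].
    have [T [FT Ty Tz]] := big _ _ _ _ FS1 FS2 S1y S2z.
    by exists T => //; have [_ + _ _] := FP T FT (ex_intro _ y Ty); exact.
  - move=> y z [T FT Ty] yz; exists T => //.
    by have [_ _ + _] := FP T FT (ex_intro _ y Ty); apply; eassumption.
  - by move=> [T FT T0]; have [_ _ _] := FP T FT (ex_intro _ _ T0).
have extend T : P T -> (S `<=` T)%classic -> (T `<=` S)%classic.
  by move=> PT ST; apply: contrapT => TS; exact: (maxS T).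
have S0 : (S !=set0)%classic.
  apply: contrapT => S0; suff : S b by move=> Sb; apply: S0; exists b.
  apply: (extend [set x | b <= x]%classic) => //=; last first.
    by move=> x Sx; case: S0; exists x.
  move=> _; split=> /= [//|x y bx by_|x y bx|]; first by rewrite lexI bx.
    exact: le_trans bx.
  by rewrite lex0 => /eqP.
have [Sb SI Sle Sbot] := PS S0.
exists S => //; split=> // [a|]; last by exists b.
have [SCa|nSCa] := pselect (S (~` a)%O); first by right.
left; pose T : set A := [set y | exists2 x, S x & (x `&` a)%O <= y]%classic.
apply: (extend T) => /=; last by exists b => //; exact: leIr.
  move=> _; split=> /=.
  - by exists b => //; exact: leIl.
  - move=> y z [x Sx xy] [x' Sx' xz]; exists (x `&` x')%O; first exact: SI.
    by rewrite -[a]meetxx meetACA; exact: leI2.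
  - by move=> y z [x Sx xy] yz; exists x => //; exact: le_trans yz.
  - move=> [x Sx]; rewrite lex0 => /eqP xa; apply: nSCa; apply: Sle Sx _.
    by rewrite -[x]meetx1 -(joinxC a) meetUr xa join0x leIr.
by move=> x Sx; exists x => //; exact: leIl.
Qed.

End UltrafilterExistence.

(** * The space of a ZLB-algebra *)

Section Spectrum.
Variables (d : Order.disp_t) (A : ctbDistrLatticeType d) (I : set A).

Definition spectrum := {u : set A | bounded_ultrafilter I u}.

HB.instance Definition _ := gen_eqMixin spectrum.
HB.instance Definition _ := gen_choiceMixin spectrum.

Definition stone (a : A) : set spectrum := [set u | sval u a].

Lemma stoneI a b : stone (a `&` b)%O = stone a `&` stone b.
Proof. by rewrite predeqE => u; exact: buf_meet (svalP u) a b. Qed.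

Lemma stoneU a b : stone (a `|` b)%O = stone a `|` stone b.
Proof. by rewrite predeqE => u; exact: buf_join (svalP u) a b. Qed.

Lemma stoneC a : stone (~` a)%O = ~` stone a.
Proof. by rewrite predeqE => u; exact: bufC (svalP u) a. Qed.

Lemma stone_le a b : (a <= b)%O -> stone a `<=` stone b.
Proof. by move=> ab u ua; apply: (buf_le (svalP u)) ab; exact: ua. Qed.

Lemma stone0 : stone \bot%O = set0.
Proof. by rewrite predeqE => u; split=> // /(buf0 (svalP u)). Qed.

Lemma stone1 : stone \top%O = setT.
Proof. by rewrite predeqE => u; split=> // _; exact: buf1 (svalP u). Qed.

(** The sets [stone a] with [a] in [A] are taken as a base: they have the same
    unions as those with [a] in [I], since every point meets [I]. *)
Definition spectrum_open (U : set spectrum) : Prop :=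
  forall u, U u -> exists2 a, stone a u & stone a `<=` U.

Lemma spectrum_openT : spectrum_open setT.
Proof. by move=> u _; exists \top%O => //; rewrite stone1. Qed.

Lemma spectrum_openI : setI_closed spectrum_open.
Proof.
move=> U V oU oV u [/oU[a ua aU] /oV[b ub bV]]; exists (a `&` b)%O.
  by rewrite stoneI.
by rewrite stoneI => v [/aU Uv /bV].
Qed.

Lemma spectrum_open_bigU (T : Type) (f : T -> set spectrum) :
  (forall i, spectrum_open (f i)) -> spectrum_open (\bigcup_i f i).
Proof. by move=> of_ u [i _ /of_[a ua af]]; exists a => // v /af; exists i. Qed.

HB.instance Definition _ := isOpenTopological.Build spectrum
  spectrum_openT spectrum_openI spectrum_open_bigU.

Lemma stone_clopen a : clopen (stone a).
Proof.
have ostone b : open (stone b) by move=> u ub; exists b.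
split=> //; rewrite -[stone a]setCK -stoneC; exact: open_closedC.
Qed.

Lemma stone_nbhs a u : stone a u -> nbhs u (stone a).
Proof.
by move=> ua; apply: open_nbhs_nbhs; split=> //; case: (stone_clopen a).
Qed.

Definition stone_CO (a : A) : CO spectrum := CO_of_clopen (stone_clopen a).

Lemma stone_CO_hom : boolean_homomorphism stone_CO.
Proof.
split=> [a b|a b|||a]; apply: val_inj => /=.
- exact: stoneI.
- exact: stoneU.
- exact: stone0.
- exact: stone1.
- exact: stoneC.
Qed.

Lemma spectrum_nbhs (u : spectrum) (U : set spectrum) :
  nbhs u U -> exists2 a, stone a u & stone a `<=` U.
Proof.
rewrite nbhsE => -[V [oV Vu] VU]; have [a ua aV] := oV u Vu.
by exists a => //; exact: subset_trans VU.
Qed.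

(** An ultrafilter of sets containing [stone a] restricts along [stone] to a
    bounded ultrafilter of [A], and converges to it. *)
Lemma stone_compact a : I a -> compact (stone a).
Proof.
move=> Ia; rewrite compact_ultra => F FU Fa; have PF := ultra_proper.
have uP : bounded_ultrafilter I [set b | F (stone b)].
  split=> [b c /= Fb Fc|b c /= Fb bc|/=|b /=|]; last by exists a.
  - by rewrite stoneI; exact: filterI.
  - by apply: filterS Fb; exact: stone_le.
  - by rewrite stone0; exact: filter_not_empty.
  - by rewrite stoneC; exact: in_ultra_setVsetC.
exists (exist _ _ uP); split=> //= U /spectrum_nbhs[b /= Fb bU].
exact: filterS Fb.
Qed.

Hypothesis IP : ideal_of setT I.

Lemma spectrum_nbhs_ideal (u : spectrum) (U : set spectrum) :
  nbhs u U -> exists2 a, I a & stone a u /\ stone a `<=` U.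
Proof.
move=> /spectrum_nbhs[a ua aU]; have [b Ib ub] := buf_bounded (svalP u).
exists (a `&` b)%O; first exact: (@ideal_le _ _ _ _ IP _ b Logic.I Ib (leIr _ _)).
by rewrite stoneI; split=> // v [/aU].
Qed.

Lemma spectrum_ZLC : ZLC_space spectrum.
Proof.
split.
- split=> [U []//|u U /spectrum_nbhs[a ua aU]].
  by exists (stone a) => //; split=> //; exact: stone_clopen.
- move=> u _.
  have [a Ia [ua _]] := spectrum_nbhs_ideal (filterT : nbhs u setT).
  exists (stone a).
    apply: filterS (stone_nbhs ua) => v av _; exact: av.
  by split; [exact: stone_compact|case: (stone_clopen a)].
move=> u v uv; suff uvE : sval u = sval v.
  by case: u v {uv} uvE => u uP [v vP] /= uv; exact: eq_exist.
have sub a : sval u a -> sval v a.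
  move=> ua; apply: contrapT => /(bufC (svalP v) a) va.
  have [w []] := uv _ _ (@stone_nbhs a u ua) (@stone_nbhs (~` a)%O v va).
  by rewrite stoneC.
rewrite predeqE => a; split; first exact: sub.
by move=> va; apply: contrapT => /(bufC (svalP u) a) /sub /(bufC (svalP v) a).
Qed.

(** A compact open set is covered by the directed family of the basic sets
    inside it, hence is one of them. *)
Lemma compact_open_stone (C : set spectrum) :
  compact C -> open C -> exists2 a, I a & C = stone a.
Proof.
move=> cC oC.
have [||||a /= [Ia aC] Ca] := @compact_directed_cover _ C _
  [set a | I a /\ stone a `<=` C] stone.
- exact: cC.
- by exists \bot%O; split; [exact: ideal0 IP|rewrite stone0].
- move=> a b [Ia aC] [Ib bC]; exists (a `|` b)%O; last by rewrite stoneU.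
  by split; [exact: idealU IP _ _ Ia Ib|rewrite stoneU subUset].
- move=> u Cu; have [|a Ia [ua aC]] := @spectrum_nbhs_ideal u C.
    exact: open_nbhs_nbhs.
  by exists a => //; exact: stone_nbhs.
by exists a => //; apply/seteqP.
Qed.

Hypothesis AI : ZLB_algebra I.

(** Density gives a nonzero element of [I] below a nonzero [a], and an ultrafilter
    through it is bounded. *)
Lemma stone_eq0 a : stone a = set0 -> a = \bot%O.
Proof.
move=> a0; apply/eqP/negP => /negP/(LBA_dense (ZLB_LBA AI))[b [Ib b0 ba]].
have [u uP ub] := bounded_ultrafilter_exists Ib b0.
have : stone a (exist _ u uP) by exact: buf_le uP _ _ ub ba.
by rewrite a0.
Qed.

Lemma stone_sub a b : stone a `<=` stone b -> (a <= b)%O.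
Proof.
move=> ab; have : (a `&` ~` b = \bot)%O.
  apply: stone_eq0; rewrite stoneI stoneC predeqE => u.
  by split=> // -[/ab].
move=> ab0; rewrite -[a]meetx1 -(joinxC b) meetUr ab0 joinx0.
exact: leIr.
Qed.

Lemma stone_inj a b : stone a = stone b -> a = b.
Proof.
by move=> ab; apply/eqP; rewrite eq_le !stone_sub ?ab.
Qed.

Lemma stone_compactP a : compact (stone a) <-> I a.
Proof.
split; last exact: stone_compact.
have [oa _] := stone_clopen a.
by move=> /compact_open_stone/(_ oa)[b Ib /stone_inj->].
Qed.

(** The elements of [I] represented inside [G] form a simple ideal, because [G]
    cuts each compact set [stone a] into two compact open pieces; its join [s]
    represents [G].  A point of [stone s] outside [G] would lie in some
    [stone a] disjoint from [G], so [~` a] would bound the ideal and hence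
    [s], which excludes the point. *)
Lemma stone_onto (G : set spectrum) : clopen G -> exists a, G = stone a.
Proof.
move=> [oG cG].
pose J := [set a | I a /\ stone a `<=` G].
have iJ : ideal_of I J.
  split=> [a []//||a b Ia [Ib bG] ab|a b [Ia aG] [Ib bG]].
  - by split; [exact: ideal0 IP|rewrite stone0].
  - split=> // u ua; apply: bG; exact: stone_le ab _ ua.
  - by split; [exact: idealU IP _ _ Ia Ib|rewrite stoneU subUset].
have split_I a : I a -> exists j k, [/\ J j, ideal_neg I J k & a = (j `|` k)%O].
  move=> Ia; have [oa ca] := stone_clopen a.
  have [j Ij jE] : exists2 j, I j & stone a `&` G = stone j.
    apply: compact_open_stone; last exact: openI.
    by apply: compact_closedI => //; exact: stone_compact.
  have [k Ik kE] : exists2 k, I k & stone a `&` ~` G = stone k.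
    apply: compact_open_stone; last by apply: openI => //; exact: closed_openC.
    by apply: compact_closedI; [exact: stone_compact|exact: open_closedC].
  exists j, k; split.
  - by split=> //; rewrite -jE => u [].
  - split=> // l [Il lG]; apply: stone_eq0; rewrite stoneI -kE predeqE => u.
    by split=> // -[[_ nG] /lG].
  by apply: stone_inj; rewrite stoneU -jE -kE -setIUr setUv setIT.
have sJ : simple_ideal I J.
  split=> //; apply/seteqP; split=> a.
    apply; [|exact: ideal_sub iJ|by move=> k []].
    by split=> // [|b c]; [exact: ideal0 IP|exact: (idealU IP)].
  move=> /split_I[j [k [Jj Kk ->]]] M iM JM KM.
  by apply: (idealU iM); [exact: JM|exact: KM].
have [s [ubs lubs]] := ZLB_join AI sJ.
exists s; apply/seteqP; split=> u.
  move=> Gu; have [|a Ia [ua aG]] := @spectrum_nbhs_ideal u G.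
    exact: open_nbhs_nbhs.
  by apply: stone_le ua; exact: ubs.
move=> us; apply: contrapT => nGu.
have [|a Ia [ua aG]] := @spectrum_nbhs_ideal u (~` G).
  by apply: open_nbhs_nbhs; split=> //; exact: closed_openC.
have : stone (~` a)%O u.
  apply: stone_le us; apply: lubs => j [Ij jG].
  by apply: stone_sub; rewrite stoneC => v /jG Gv /aG.
by rewrite stoneC.
Qed.

End Spectrum.

(** * The duality *)

Lemma boolean_homomorphism_can d d' (A : ctbDistrLatticeType d)
    (B : ctbDistrLatticeType d') (phi : A -> B) (phi' : B -> A) :
  cancel phi phi' -> cancel phi' phi ->
  boolean_homomorphism phi -> boolean_homomorphism phi'.
Proof.
move=> phiK phi'K hphi; split=> [a b|a b|||a]; apply: (can_inj phiK).
- by rewrite (bool_homI hphi) !phi'K.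
- by rewrite (bool_homU hphi) !phi'K.
- by rewrite (bool_hom0 hphi) !phi'K.
- by rewrite (bool_hom1 hphi) !phi'K.
- by rewrite (bool_homC hphi) !phi'K.
Qed.

(** The preadjoint of an isomorphism is the inverse isomorphism. *)
Lemma OZLBA_hom_of_iso (A B : ZLBA_obj) (phi : A -> B) (phi' : B -> A) :
  boolean_homomorphism phi -> cancel phi phi' -> cancel phi' phi ->
  (forall a, @ZLBA_ideal B (phi a) <-> @ZLBA_ideal A a) ->
  exists h : @hom OZLBA A B, sval (sval h) = phi.
Proof.
move=> hphi phiK phi'K phiI.
have mphi : ZLBA_morphism (@ZLBA_ideal A) (@ZLBA_ideal B) phi.
  by split=> // b Ib; exists (phi' b); [apply/phiI|]; rewrite phi'K.
pose m : @hom ZLBA A B := exist _ phi mphi.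
suff pm : has_lower_P_preadjoint m by exists (exist _ m pm).
have psiP (b : @ZLBA_ideal B) : phi' (val b) \in @ZLBA_ideal A.
  by apply/mem_set/phiI; rewrite phi'K; exact: set_mem (valP b).
exists (fun b => exist (fun a : A => a \in @ZLBA_ideal A) _ (psiP b)); split.
  move=> a b _ /= ba; apply: (can_inj phiK).
  by rewrite (bool_homI hphi) phi'K ba (bool_hom0 hphi).
by move=> b /=; rewrite phi'K.
Qed.

Lemma OZLBA_isomorphism (A B : ZLBA_obj) (phi : A -> B) :
  boolean_homomorphism phi -> bijective phi ->
  (forall a, @ZLBA_ideal B (phi a) <-> @ZLBA_ideal A a) ->
  exists h : @hom (opposite OZLBA) B A, isomorphism h.
Proof.
move=> hphi [phi' phiK phi'K] phiI.
have [h hE] := OZLBA_hom_of_iso hphi phiK phi'K phiI.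
have hphi' := boolean_homomorphism_can phiK phi'K hphi.
have [|h' h'E] := OZLBA_hom_of_iso hphi' phi'K phiK.
  by move=> b; rewrite -phiI phi'K.
exists h, h'; split; do 2 apply: eq_exist => /=.
  by rewrite hE h'E; apply/funext => b /=; rewrite phi'K.
by rewrite hE h'E; apply/funext => a /=; rewrite phiK.
Qed.

Section ClopenFunctor.

Definition CO_obj (X : OZLC) : OZLBA :=
  ZLBAObj (CO_ZLB (ZLC_topP X)).

Definition CO_hom (X Y : ZLC_obj) (f : continuousType X Y) :
  @hom ZLBA (CO_obj Y) (CO_obj X) :=
  exist _ (CO_preimage f) (CO_preimage_morphism (ZLC_topP Y) f).

Definition CO_map (X Y : OZLC) (f : hom X Y) :
    @hom (opposite OZLBA) (CO_obj X) (CO_obj Y) :=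
  exist _ (CO_hom (sval f))
    (open_map_preadjoint (ZLC_topP Y) (svalP f)).

Lemma CO_map_id (X : OZLC) : CO_map (idm X) = idm (CO_obj X).
Proof.
by do 2 apply: eq_exist => /=; apply/funext => G; apply: val_inj.
Qed.

Lemma CO_map_comp (X Y Z : OZLC) (g : hom Y Z) (f : hom X Y) :
  CO_map (comp g f) = comp (CO_map g) (CO_map f).
Proof.
by do 2 apply: eq_exist => /=; apply/funext => G; apply: val_inj.
Qed.

Definition CO_functor : functor OZLC (opposite OZLBA) :=
  @Functor OZLC (opposite OZLBA) CO_obj CO_map CO_map_id CO_map_comp.

Lemma CO_functor_faithful (X Y : OZLC) (f g : hom X Y) :
  fmap CO_functor f = fmap CO_functor g -> f = g.
Proof.
move=> /(congr1 (fun h => sval (sval h))) /= fg.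
case: f g fg => f fo [g go] /= fg; apply: eq_exist.
by apply: (CO_preimage_inj (ZLC_topP Y)) => G; rewrite fg.
Qed.

Lemma CO_functor_full (X Y : OZLC) (h : hom (CO_functor X) (CO_functor Y)) :
  exists f, fmap CO_functor f = h.
Proof.
case: h => -[phi phiP] psiP.
have [f fphi] := CO_preimage_full (ZLC_topP X) (ZLC_topP Y) phiP.
have {}fphi : CO_preimage f = phi by exact/funext.
have fo : open_map f.
  apply: (preadjoint_open_map (ZLC_topP X) (ZLC_topP Y)).
  by rewrite fphi; exact: psiP.
by exists (exist _ f fo); do 2 apply: eq_exist => /=.
Qed.

Lemma CO_functor_esurj (A : opposite OZLBA) :
  exists (X : OZLC) (h : hom (CO_functor X) A), isomorphism h.
Proof.
case: A => d A I AI.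
have IP := LBA_ideal (ZLB_LBA AI).
pose X : OZLC := ZLCObj (spectrum_ZLC IP); exists X.
apply: (@OZLBA_isomorphism (ZLBAObj AI) (CO_obj X) (stone_CO I)).
- exact: stone_CO_hom.
- have /all_sig[inv invP] (G : CO (spectrum I)) :
      {a | G = stone_CO I a}.
    apply: cid; have [a Ga] := stone_onto IP AI (CO_clopen G).
    by exists a; apply: val_inj.
  exists inv => [a|G]; last by rewrite -invP.
  apply: (stone_inj AI); by rewrite -[LHS]/(val (stone_CO I _)) -invP.
- exact: stone_compactP IP AI.
Qed.

End ClopenFunctor.

Theorem theorem2p8 :
  (forall (X Y : topologicalType) (f : continuousType X Y),
     ZLC_space X -> ZLC_space Y ->
     (open_map f <->
      exists psi : CK X -> CK Y,
        OZL1 (CO_preimage f) psi /\ OZL2 (CO_preimage f) psi))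
  /\ dually_equivalent OZLC OZLBA.
Proof.
split=> [X Y f ZX ZY|].
  split; [exact: open_map_preadjoint|exact: preadjoint_open_map].
exact: full_faithful_esurj_equivalent CO_functor_faithful CO_functor_full
  CO_functor_esurj.
Qed.
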